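(* Let $G$ be an $r$-regular graph on $n$ vertices with at least one edge (i.e. $r\ge 1$), let $\alpha(G)$ be the independence number of $G$, and let $\beta_o:=\beta_o(G)$. Then $$\alpha(G)\le n\left(\frac{1-\beta_o}{\beta_o}\right).$$
   Context: All graphs are simple and undirected, with a finite vertex set. $A(G)$ is the adjacency matrix, $D(G)$ the diagonal matrix of vertex degrees, and $L(G)=D(G)-A(G)$ the Laplacian matrix of $G$. For $\beta\in[0,1]$, $B_\beta(G):=\beta A(G)+(1-\beta)L(G)$. The eigenvalues of a real symmetric $n\times n$ matrix $S$ are ordered $\lambda_1(S)\ge\lambda_2(S)\ge\cdots\ge\lambda_n(S)$ (with multiplicity). For a graph $G$ on $n$ vertices with at least one edge, $\beta_o(G):=\max\{\beta\in(0,1):\lambda_n(B_\beta(G))=0\}$. The independence number is the maximum size of a set of pairwise non-adjacent vertices. *)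

(* Defs.v *)
From mathcomp Require Import all_boot all_order all_algebra.
From mathcomp Require Import polyrcf.
From mathcomp Require Import classical_sets reals.

Set Implicit Arguments.
Unset Strict Implicit.
Unset Printing Implicit Defensive.

Import Order.TTheory GRing.Theory Num.Theory.
Local Open Scope ring_scope.

Record sgraph := SGraph {
  vertex :> finType;
  adj : rel vertex;
  adj_sym : symmetric adj;
  adj_irr : irreflexive adj }.

Section Graph.
Variable G : sgraph.

Definition nvertices : nat := #|vertex G|.

Definition degree (v : G) : nat := #|[set w : G | adj v w]|.

Definition regular (r : nat) : Prop := forall v : G, degree v = r.

Definition has_edge : Prop := exists u v : G, adj u v.

Definition independent (S : {set G}) : bool :=
  [forall u in S, forall v in S, ~~ adj u v].

Definition independence_number : nat :=
  (\max_(S : {set G} | independent S) #|S|)%N.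

End Graph.

Section Spectrum.
Variable R : rcfType.

(* All real eigenvalues in nonincreasing order, each repeated according to its
   multiplicity as a root of the characteristic polynomial (rootsR lists the
   distinct real roots increasingly). For a symmetric S this list has size n. *)
Definition spectrum n (S : 'M[R]_n) : seq R :=
  flatten [seq nseq (mup a (char_poly S)) a | a <- rev (rootsR (char_poly S))].

(* The index k starts from 1, so that lambda n S is the least eigenvalue of a
   symmetric n x n matrix S with n > 0. *)
Definition lambda (k : nat) n (S : 'M[R]_n) : R := (spectrum S)`_k.-1.

End Spectrum.

Section GraphMatrices.
Variables (R : realType) (G : sgraph).

Definition adj_mx : 'M[R]_(nvertices G) :=
  \matrix_(i, j) (adj (enum_val i : G) (enum_val j : G))%:R.

Definition degree_mx : 'M[R]_(nvertices G) :=
  diag_mx (\row_i (degree (enum_val i : G))%:R).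

Definition laplacian_mx : 'M[R]_(nvertices G) := degree_mx - adj_mx.

Definition B_mx (beta : R) : 'M[R]_(nvertices G) :=
  beta *: adj_mx + (1 - beta) *: laplacian_mx.

Definition beta_set : set R :=
  [set beta : R | 0 < beta < 1 /\ lambda (nvertices G) (B_mx beta) = 0]%classic.

(* The maximum of beta_set, i.e. its unique element that is an upper bound of
   it; the junk value 0 is taken only when there is no maximum. *)
Definition beta_o : R := xget 0 (beta_set `&` ubound beta_set)%classic.

End GraphMatrices.

(* Main.v *)
Require Import Defs.
From mathcomp Require Import all_boot all_order all_algebra.
From mathcomp Require Import reals.
From mathcomp Require Import classical_sets.
From mathcomp Require Import sesquilinear spectral complex polyrcf.
From mathcomp Require Import ring lra.

Import Order.TTheory GRing.Theory Num.Theory.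
Local Open Scope ring_scope.

(** Write [A] for the adjacency matrix of the [r]-regular graph [G] and [mu]
    for the least eigenvalue of [A]. Regularity turns [B_beta] into an affine
    function of [A]:
      [B_beta = (1 - beta) r I + (2 beta - 1) A],
    so that the quadratic form of [B_beta] at a [mu]-eigenvector [v] of [A] is
    [((1 - beta) r + (2 beta - 1) mu) |v|^2 = (b0 - beta) (r - 2 mu) |v|^2]
    with [b0 = (r - mu) / (r - 2 mu)]. As [G] has an edge, [mu < 0]; hence
    [1/2 <= b0 < 1]. Every [beta > b0] makes the form negative at [v], hence
    gives [B_beta] a negative eigenvalue, whereas [B_b0] is positive
    semidefinite and singular. So the maximum defining [beta_o] exists (it is
    [b0]) and, at [beta_o], the matrix [B] is positive semidefinite
    ([beta_o_mem], [lambda_B_mx0_psd]).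

    The bound on an independent set [S] is then the ratio bound of Hoffman
    ([ratio_bound]): all row sums of [B] equal [beta_o r], and the principal
    submatrix of [B] on [S] is the scalar matrix [(1 - beta_o) r]. The form of
    [B] at [n 1_S - |S| 1] is nonnegative, and expanding it gives
    [beta_o r |S| <= (1 - beta_o) r n].

    Both halves use the spectral theorem only in the form [lambda_rayleigh]:
    for a symmetric [S], the last entry of its ordered spectrum is an
    eigenvalue, and [lambda |x|^2 <= x S x^T] for every row vector [x]. It is
    deduced from the unitary diagonalization of normal matrices over [R[i]]. *)

(** * Quadratic forms *)

Definition quad {K : pzRingType} {n : nat} (S : 'M[K]_n) (x : 'rV[K]_n) : K :=
  (x *m S *m x^T) 0 0.

Lemma quadE {K : comPzRingType} {n : nat} (S : 'M[K]_n) (x : 'rV[K]_n) :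
  quad S x = \sum_i \sum_j x 0 i * S i j * x 0 j.
Proof.
rewrite /quad mxE exchange_big /=; apply: eq_bigr => j _.
by rewrite !mxE mulr_suml.
Qed.

Lemma quadD {K : comPzRingType} {n : nat} (S T : 'M[K]_n) (x : 'rV[K]_n) :
  quad (S + T) x = quad S x + quad T x.
Proof. by rewrite /quad mulmxDr mulmxDl mxE. Qed.

Lemma quadZ {K : comPzRingType} {n : nat} a (S : 'M[K]_n) (x : 'rV[K]_n) :
  quad (a *: S) x = a * quad S x.
Proof. by rewrite /quad -scalemxAr -scalemxAl mxE. Qed.

Lemma quad1_gt0 {K : realFieldType} {n : nat} (x : 'rV[K]_n) :
  x != 0 -> 0 < quad 1%:M x.
Proof.
have q : quad 1%:M x = \sum_i x 0 i ^+ 2.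
  by rewrite /quad mulmx1 mxE; apply: eq_bigr => i _; rewrite mxE expr2.
move=> x0; rewrite lt_def q sumr_ge0 ?andbT => [|i _]; last exact: sqr_ge0.
apply: contraNneq x0 => /eqP; rewrite psumr_eq0 => [/allP s0|i _];
  last exact: sqr_ge0.
apply/eqP/rowP => i; rewrite mxE; apply/eqP.
by have := s0 i (mem_index_enum i); rewrite /= sqrf_eq0.
Qed.

(** Evaluated at the two ends of an edge, this shows that an adjacency matrix
    takes a negative value. *)
Lemma quad_delta_sub {K : comPzRingType} {n : nat} (S : 'M[K]_n) (i j : 'I_n) :
  quad S (delta_mx 0 i - delta_mx 0 j) = S i i - S i j - S j i + S j j.
Proof.
have SE k l : ((delta_mx 0 k : 'rV_n) *m S *m (delta_mx 0 l : 'rV_n)^T) 0 0 = S k l.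
  by rewrite trmx_delta -rowE -colE !mxE.
rewrite /quad linearB /= mulmxBl mulmxBr !mulmxBl.
have subE (A B : 'M[K]_1) : (A - B) 0 0 = A 0 0 - B 0 0 by rewrite !mxE.
by rewrite !(subE, SE); ring.
Qed.

Lemma quad_eigen {K : fieldType} {n : nat} (S : 'M[K]_n) a (v : 'rV[K]_n) :
  v *m S = a *: v -> quad S v = a * quad 1%:M v.
Proof. by rewrite /quad mulmx1 => ->; rewrite -scalemxAl mxE. Qed.

(** * The least eigenvalue of a real symmetric matrix *)

Lemma char_poly_conj_diag {K : fieldType} {n : nat} (P : 'M[K]_n) (d : 'rV[K]_n) :
  P \in unitmx ->
  char_poly (invmx P *m diag_mx d *m P) = \prod_i ('X - (d 0 i)%:P).
Proof.
move=> Pu; pose f (A : 'M[K]_n) := map_mx (@polyC K) A.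
have fu : f (invmx P) *m f P = 1%:M by rewrite /f -map_mxM mulVmx // map_mx1.
have -> : char_poly (invmx P *m diag_mx d *m P) = char_poly (diag_mx d).
  rewrite /char_poly.
  have -> : char_poly_mx (invmx P *m diag_mx d *m P)
    = f (invmx P) *m char_poly_mx (diag_mx d) *m f P.
    rewrite /f /char_poly_mx !map_mxM mulmxBr mulmxBl.
    by rewrite scalar_mxC -[X in _ = X - _]mulmxA fu mulmx1.
  by rewrite !det_mulmx mulrAC -det_mulmx fu det1 mul1r.
rewrite char_poly_trig ?diag_mx_is_trig //.
by apply: eq_bigr => i _; rewrite !mxE eqxx.
Qed.

(** The spectral theorem, keeping only what survives without mentioning complex
    numbers: the unitary matrix [P] that diagonalizes [S] over [R[i]] has no
    reason to be real, but its eigenvalues are, and [y = x P^-1] satisfies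
    [x S x^T = sum_i d_i |y_i|^2] and [x x^T = sum_i |y_i|^2]. *)
Lemma symmetric_diagonalization {R : rcfType} {n : nat} (S : 'M[R]_n) :
  S^T = S ->
  exists d : 'rV[R]_n,
    char_poly S = \prod_i ('X - (d 0 i)%:P) /\
    forall (m : R) (x : 'rV[R]_n),
      (forall i, m <= d 0 i) -> m * quad 1%:M x <= quad S x.
Proof.
move=> Ssym; pose c := map_mx (real_complex R).
have cconj k l (A : 'M[R]_(k, l)) : map_mx Num.conj (c _ _ A) = c _ _ A.
  apply/matrixP => i j; rewrite !mxE; apply/CrealP/complex_realP; by eexists.
have cS : c _ _ S \is hermsymmx.
  by apply/is_hermitianmxP; rewrite expr0 scale1r -map_trmx cconj /c map_trmx Ssym.
set D := spectral_diag (c _ _ S); set P := spectralmx (c _ _ S).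
have PD : c _ _ S = invmx P *m diag_mx D *m P.
  exact/orthomx_spectralP/hermitian_normalmx.
pose d : 'rV[R]_n := \row_i complex.Re (D 0 i).
have dD i : D 0 i = real_complex R (d 0 i).
  rewrite mxE; apply/esym/RRe_real.
  exact: (mxOverP (hermitian_spectral_diag_real _)).
exists d; split=> [|m x md].
  apply: (map_inj_poly (@complexI R) (rmorph0 _)).
  rewrite map_char_poly -/(c _ _ S) PD char_poly_conj_diag ?spectral_unit //.
  rewrite rmorph_prod; apply: eq_bigr => i _ /=.
  by rewrite rmorphB /= map_polyX map_polyC dD.
have Pu : P \is unitarymx by exact: spectral_unitarymx.
pose y := c _ _ x *m invmx P.
(* [x] is real and [P] unitary, so the conjugate transpose of [x P^-1] is
   [P x^T]. *)
have yt : map_mx Num.conj (y^T) = P *m (c _ _ x)^T.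
  rewrite /y invmx_unitary // trmx_mul map_mxM -!map_trmx cconj.
  by rewrite trmxK -map_mx_comp (map_mx_id (@conjCK _)).
have qc A : real_complex R (quad A x) = (c _ _ x *m c _ _ A *m (c _ _ x)^T) 0 0.
  by rewrite /c map_trmx -!map_mxM mxE.
have qS : real_complex R (quad S x) = \sum_i D 0 i * `|y 0 i| ^+ 2.
  rewrite qc PD !mulmxA -/y -mulmxA -yt mxE; apply: eq_bigr => i _.
  by rewrite mul_mx_diag !mxE mulrAC normCK mulrC; ring.
have q1 : real_complex R (quad 1%:M x) = \sum_i `|y 0 i| ^+ 2.
  rewrite qc /c map_mx1 mulmx1 -/(c _ _ x).
  have -> : c _ _ x *m (c _ _ x)^T = y *m map_mx Num.conj y^T.
    by rewrite yt /y !mulmxA mulmxKV ?spectral_unit.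
  by rewrite mxE; apply: eq_bigr => i _; rewrite !mxE normCK.
rewrite -lecR rmorphM /= q1 qS mulr_sumr; apply: ler_sum => i _.
by rewrite dD ler_wpM2r ?exprn_ge0 // lecR.
Qed.

(** The list [spectrum S] is cut by multiplicities of real roots, so its entry of
    index [n - 1] is its last one only if all [n] roots are real. Granting
    that, the last block of the list repeats the first, hence least, element
    of [rootsR]. *)
Lemma lambda_prod_XsubC {R : rcfType} {n : nat} (S : 'M[R]_n) (d : 'rV[R]_n) :
  (0 < n)%N -> char_poly S = \prod_i ('X - (d 0 i)%:P) ->
  eigenvalue S (lambda n S) /\ forall i, lambda n S <= d 0 i.
Proof.
move=> n_gt0; set p := char_poly S; set rts := rootsR p.
pose s := [seq d 0 i | i <- enum 'I_n].
have -> : \prod_i ('X - (d 0 i)%:P) = \prod_(a <- s) ('X - a%:P).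
  by rewrite big_map big_enum.
move=> ps; have p0 : p != 0 by exact/monic_neq0/char_poly_monic.
have mups a : mup a p = count_mem a s by rewrite ps mu_prod_XsubC.
have size_s : size s = n by rewrite size_map size_enum_ord.
have rtsP a : (a \in rts) = root p a by have /(_ a) := roots_on_rootsR p0.
have ms a : (a \in rts) = (a \in s) by rewrite rtsP ps root_prod_XsubC.
have srt : sorted <%R rts by exact: sorted_roots.
have size_sp : size (spectrum S) = n.
  rewrite -[in RHS]size_s; apply/perm_size; rewrite -(permPr (perm_count_undup s)).
  rewrite /spectrum (eq_map (g := fun a => nseq (count_mem a s) a)); last first.
    by move=> a; rewrite -mups.
  apply/perm_flatten/perm_map; rewrite perm_rev; apply: uniq_perm.
  - exact: lt_sorted_uniq.
  - exact: undup_uniq.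
  - by move=> a; rewrite mem_undup ms.
case E : rts => [|m t].
  have : s`_0 \in rts by rewrite ms mem_nth ?size_s.
  by rewrite E.
have mp : root p m by rewrite -rtsP E mem_head.
have -> : lambda n S = m.
  rewrite /lambda -[X in _`_X.-1]size_sp nth_last /spectrum -/p -/rts E.
  rewrite rev_cons map_rcons flatten_rcons last_cat.
  have : (0 < mup m p)%N by rewrite -XsubC_dvd // -root_factor_theorem.
  by case: mup => // k _ /=; elim: k.
split=> [|i]; first by rewrite eigenvalue_root_char.
have : d 0 i \in rts by rewrite ms map_f // mem_enum.
rewrite E in_cons => /predU1P[-> //|it].
by move: srt; rewrite E /= lt_path_sortedE => /andP[/allP/(_ _ it)/ltW].
Qed.

(** Everything that the graph-theoretic part needs to know about [lambda]. *)
Lemma lambda_rayleigh {R : rcfType} {n : nat} (S : 'M[R]_n) :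
  (0 < n)%N -> S^T = S ->
  eigenvalue S (lambda n S) /\
  forall x : 'rV[R]_n, lambda n S * quad 1%:M x <= quad S x.
Proof.
move=> n0 /symmetric_diagonalization[d [dp dq]].
have [ev le_d] := lambda_prod_XsubC S d n0 dp; split=> // x; exact: dq.
Qed.

(** * The ratio bound *)

(** The vector [n 1_T - |T| 1] is, up to scaling, the component of the indicator
    of [T] orthogonal to the eigenvector [1]; the form of [M] there equals
    [n |T| (d n - k |T|)]. *)
Lemma ratio_bound {K : realFieldType} {n : nat} (M : 'M[K]_n)
    (T : {set 'I_n}) (k d : K) :
  M^T = M -> (forall x : 'rV[K]_n, 0 <= quad M x) ->
  M *m (const_mx 1 : 'cV[K]_n) = const_mx k ->
  {in T &, forall i j, M i j = d *+ (i == j)} ->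
  (0 < #|T|)%N -> k * #|T|%:R <= d * n%:R.
Proof.
move=> Msym psd row_sum diagT T0.
pose e : 'rV[K]_n := \row_i (i \in T)%:R.
pose j : 'rV[K]_n := const_mx 1.
have eM : (e *m M *m e^T) 0 0 = d * #|T|%:R.
  rewrite -/(quad M e) quadE (bigID (mem T)) /=.
  rewrite [X in _ + X]big1 => [|i /negPf iT]; last first.
    by rewrite big1 // => l _; rewrite mxE iT !mul0r.
  rewrite addr0 mulr_natr -sumr_const; apply: eq_bigr => i iT.
  rewrite (bigD1 i) //= !mxE iT diagT // eqxx mul1r mulr1 big1 ?addr0 // => l li.
  rewrite !mxE; case lT: (l \in T); last by rewrite mulr0.
  by rewrite diagT // eq_sym (negPf li) mulr0 mul0r.
have Mj : M *m j^T = k *: j^T.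
  by rewrite trmx_const row_sum; apply/matrixP => a b; rewrite !mxE mulr1.
have jM : j *m M = k *: j.
  by apply: trmx_inj; rewrite trmx_mul Msym Mj linearZ.
have ej : (e *m j^T) 0 0 = #|T|%:R.
  rewrite mxE -sum1_card natr_sum [RHS]big_mkcond; apply: eq_bigr => i _.
  by rewrite !mxE mulr1; case: ifP.
have je : (j *m e^T) 0 0 = #|T|%:R.
  by rewrite -ej -[j in LHS]trmxK -trmx_mul [LHS]mxE.
have jj : (j *m j^T) 0 0 = n%:R.
  rewrite mxE (eq_bigr (fun=> 1)) ?sumr_const ?card_ord // => i _.
  by rewrite !mxE mulr1.
have n0 : (0 < n)%N by rewrite -[n]card_ord (leq_trans T0) // max_card.
have {psd} := psd (n%:R *: e - #|T|%:R *: j).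
have -> : quad M (n%:R *: e - #|T|%:R *: j) =
  n%:R * #|T|%:R * (d * n%:R - k * #|T|%:R).
  have subE (A B : 'M[K]_1) : (A - B) 0 0 = A 0 0 - B 0 0 by rewrite !mxE.
  have scaleE a (A : 'M[K]_1) : (a *: A) 0 0 = a * A 0 0 by rewrite mxE.
  have uT : (n%:R *: e - #|T|%:R *: j)^T = n%:R *: e^T - #|T|%:R *: j^T.
    by apply/colP => l; rewrite !mxE.
  rewrite /quad uT mulmxBl -!scalemxAl jM.
  rewrite mulmxBr !mulmxBl -!scalemxAl -!scalemxAr -[e *m M *m j^T]mulmxA Mj.
  rewrite -!scalemxAr !(subE, scaleE) eM ej je jj; ring.
by rewrite pmulr_rge0 ?mulr_gt0 ?ltr0n // subr_ge0.
Qed.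

(** * Regular graphs *)

Section RegularGraph.
Variables (R : realType) (G : sgraph) (r : nat).
Hypotheses (G_regular : regular G r) (G_edge : has_edge G).

Notation n := (nvertices G).
Notation A := (adj_mx R G).
Notation mu := (lambda n A).

Lemma adj_mx_sym : A^T = A.
Proof. by apply/matrixP => i j; rewrite !mxE adj_sym. Qed.

Lemma nvertices_gt0 : (0 < n)%N.
Proof. by case: G_edge => u _; apply/card_gt0P; exists u. Qed.

Lemma B_mx_regular (b : R) :
  B_mx G b = ((1 - b) * r%:R)%:M + (2 * b - 1) *: A.
Proof.
apply/matrixP => i j; rewrite !mxE G_regular.
case: eqVneq => [->|_]; rewrite ?mulr1n ?mulr0n; ring.
Qed.

Lemma B_mx_sym (b : R) : (B_mx G b)^T = B_mx G b.
Proof. by rewrite B_mx_regular linearD linearZ /= adj_mx_sym tr_scalar_mx. Qed.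

Lemma quad_B_mx (b : R) x :
  quad (B_mx G b) x = (1 - b) * r%:R * quad 1%:M x + (2 * b - 1) * quad A x.
Proof. by rewrite B_mx_regular quadD quadZ -scalemx1 quadZ. Qed.

Lemma adj_mx_row_sum : A *m (const_mx 1 : 'cV[R]_n) = const_mx r%:R.
Proof.
apply/colP => i; rewrite !mxE -(G_regular (enum_val i)) /degree -sum1_card natr_sum.
rewrite [RHS]big_mkcond [RHS](reindex (fun j : 'I_n => enum_val j : G)) /=;
  last exact/onW_bij/enum_val_bij.
by apply: eq_bigr => j _; rewrite !mxE mulr1 inE; case: adj.
Qed.

Lemma B_mx_row_sum (b : R) :
  B_mx G b *m (const_mx 1 : 'cV[R]_n) = const_mx (b * r%:R).
Proof.
rewrite B_mx_regular mulmxDl mul_scalar_mx -scalemxAl adj_mx_row_sum.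
by apply/colP => i; rewrite !mxE; ring.
Qed.

(** An edge [uv] gives the value [-2] to the form of [A] at [e_u - e_v], so the
    least Rayleigh quotient is negative. *)
Lemma lambda_adj_lt0 : mu < 0.
Proof.
have [_ ray] := lambda_rayleigh A nvertices_gt0 adj_mx_sym.
have [u [v uv]] := G_edge.
have uNv : u != v by apply: contraTneq uv => ->; rewrite adj_irr.
pose i : 'I_n := enum_rank u; pose j : 'I_n := enum_rank v.
have ji : (j == i) = false by rewrite (inj_eq enum_rank_inj) eq_sym (negPf uNv).
pose x : 'rV[R]_n := delta_mx 0 i - delta_mx 0 j.
have qA : quad A x = - 2.
  by rewrite quad_delta_sub !mxE !enum_rankK !adj_irr uv adj_sym uv sub0r addr0 -opprD.
have x0 : x != 0.
  apply/eqP => /rowP/(_ i)/eqP; rewrite !mxE !eqxx [i == j]eq_sym ji subr0.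
  by rewrite oner_eq0.
have := quad1_gt0 x x0; have := ray x; rewrite qA => h1 h2.
rewrite ltNge; apply/negP => mu0.
have := mulr_ge0 mu0 (ltW h2); lra.
Qed.

Lemma lambda_B_mx0_psd (b : R) :
  lambda n (B_mx G b) = 0 -> forall x, 0 <= quad (B_mx G b) x.
Proof.
move=> l0 x; have [_ /(_ x)] := lambda_rayleigh _ nvertices_gt0 (B_mx_sym b).
by rewrite l0 mul0r.
Qed.

(** The content is that the maximum is attained, so that [beta_o] is not the
    default value: [b0 = (r - mu) / (r - 2 mu)] lies in the set and bounds it. *)
Lemma beta_o_mem : 0 < beta_o R G < 1 /\ lambda n (B_mx G (beta_o R G)) = 0.
Proof.
have n0 := nvertices_gt0; have mu0 := lambda_adj_lt0.
have [/eigenvalueP[v vA v0] ray] := lambda_rayleigh A n0 adj_mx_sym.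
have v_gt0 := quad1_gt0 v v0; have qv := quad_eigen A _ v vA.
have r_ge0 : (0 : R) <= r%:R by exact: ler0n.
have D0 : 0 < r%:R - 2 * mu by lra.
pose b0 := (r%:R - mu) / (r%:R - 2 * mu).
suff b0max : (@beta_set R G `&` ubound (@beta_set R G))%classic b0.
  by have [] := xgetPex 0 (ex_intro _ b0 b0max).
(* The left side is the eigenvalue of [B_b] at the eigenvector [v] of [A]. *)
have coef (b : R) : (1 - b) * r%:R + (2 * b - 1) * mu = (b0 - b) * (r%:R - 2 * mu).
  by rewrite /b0; field; rewrite gt_eqF.
split.
  split; first by rewrite /b0 divr_gt0 ?ltr_pdivrMr ?mul1r //; lra.
  have b0_half : 0 <= 2 * b0 - 1.
    have -> : 2 * b0 - 1 = r%:R / (r%:R - 2 * mu).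
      by rewrite /b0; field; rewrite gt_eqF.
    by rewrite divr_ge0 // ltW.
  (* The least eigenvalue of [B_b0] is at most [0] because of [v], and at least
     [0] because [B_b0] is the nonnegative multiple [2 b0 - 1] of [A - mu I]. *)
  have [/eigenvalueP[w wB w0] rayB] := lambda_rayleigh _ n0 (B_mx_sym b0).
  apply/eqP; rewrite eq_le; apply/andP; split.
    have := rayB v; rewrite quad_B_mx qv mulrA -mulrDl coef subrr !mul0r.
    by rewrite pmulr_lle0.
  rewrite -(pmulr_lge0 _ (quad1_gt0 w w0)) -(quad_eigen _ _ w wB) quad_B_mx.
  apply: le_trans (_ : 0 <= ((1 - b0) * r%:R + (2 * b0 - 1) * mu) * quad 1%:M w) _.
    by rewrite coef subrr !mul0r.
  by rewrite mulrDl -[X in _ + X <= _]mulrA lerD2l ler_wpM2l.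
move=> b [_ lb]; have := lambda_B_mx0_psd b lb v.
by rewrite quad_B_mx qv mulrA -mulrDl coef pmulr_lge0 // pmulr_lge0 // subr_ge0.
Qed.

Lemma independent_card_bound (b : R) (S : {set G}) :
  0 < b < 1 -> lambda n (B_mx G b) = 0 -> independent S ->
  #|S|%:R <= n%:R * ((1 - b) / b).
Proof.
move=> /andP[b0 b1] lb indS.
have [S0|S_gt0] := posnP #|S|.
  by rewrite S0 mulr_ge0 ?divr_ge0 // ?subr_ge0 ?ltW.
have r_gt0 : (0 : R) < r%:R.
  have [u [v uv]] := G_edge; rewrite ltr0n -(G_regular u).
  by apply/card_gt0P; exists v; rewrite inE.
pose T : {set 'I_n} := (fun i : 'I_n => enum_val i : G) @^-1: S.
have cardT : #|T| = #|S|.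
  by apply: on_card_preimset; exact/onW_bij/enum_val_bij.
suff bound : b * r%:R * #|T|%:R <= (1 - b) * r%:R * n%:R.
  by rewrite mulrA ler_pdivlMr // -(ler_pM2l r_gt0) -cardT; lra.
apply: (ratio_bound (B_mx G b)) => [|x||i j|].
- exact: B_mx_sym.
- exact: lambda_B_mx0_psd.
- exact: B_mx_row_sum.
- rewrite !inE => iS jS; rewrite B_mx_regular !mxE.
  have /negPf-> : ~~ adj (enum_val i : G) (enum_val j).
    by move: indS => /forall_inP/(_ _ iS)/forall_inP/(_ _ jS).
  by rewrite mulr0 addr0.
- by rewrite cardT.
Qed.

End RegularGraph.

Theorem proposition3p2 (R : realType) (G : sgraph) (r : nat)
    (G_regular : regular G r) (G_edge : has_edge G) :
  (independence_number G)%:R <=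
    (nvertices G)%:R * ((1 - beta_o R G) / beta_o R G) :> R.
Proof.
have [b01 lb] := beta_o_mem R G r G_regular G_edge.
have indep0 : @independent G finset.set0 by apply/forall_inP => u; rewrite inE.
rewrite /independence_number (bigop.bigmax_eq_arg finset.set0 indep0).
case: arg_maxnP => // S indS _.
exact: (independent_card_bound R G r).
Qed.
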